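(* Let $A=\{a_k\}_{k\in\mathbb{Z}}$ be a sequence of complex numbers with $a_k=o(k^{\alpha})$ as $k\to\pm\infty$ for some $\alpha<1$. Let $n\in\mathbb{Z}$. If $|s-n|<1$ with $s\neq n$, then $$\pi\cot(\pi s;A)=\frac{a_{|n|}}{s-n}-\sum_{j=1}^\infty(-\sigma_n)^jR^{(A)}_{|n|}(j)(s-n)^{j-1},$$ where $\sigma_n:=1$ if $n\ge0$ and $\sigma_n:=-1$ if $n<0$.
   Context: The growth condition $a_k=o(k^\alpha)$ is understood with $|k|^\alpha$ for negative $k$. Cotangent function with sequence $A$: $$\pi\cot(\pi s;A):=-\frac{a_0}{s}+\Psi(-s;A)-\Psi(s;A)=\frac{a_0}{s}-2s\sum_{k=1}^\infty\frac{a_k}{k^2-s^2},$$ where $\Psi(-s;A):=\frac{a_0}{s}+\sum_{k=1}^\infty\left(\frac{a_k}{k}-\frac{a_k}{k-s}\right)$. For integers $j\ge1$, $n\ge0$: $E^{(A)}_n(j):=\sum_{k=1}^n \frac{a_{n-k}}{k^j}$, $E^{(A)}_0(j):=0$; $\bar E^{(A)}_n(j):=\sum_{k=1}^n \frac{a_{k-n-1}}{k^j}$, $\bar E^{(A)}_0(j):=0$; $F^{(A)}_n(1):=\sum_{k=1}^\infty\frac{a_{k+n}-a_k}{k}$, $F^{(A)}_n(j):=\sum_{k=1}^\infty\frac{a_{k+n}}{k^j}$ for $j>1$; $\bar F^{(A)}_n(1):=\sum_{k=1}^\infty\frac{a_{k-n}-a_k}{k}$, $\bar F^{(A)}_n(j):=\sum_{k=1}^\infty\frac{a_{k-n}}{k^j}$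 for $j>1$; $G^{(A)}_n(j):=E^{(A)}_n(j)-\bar E^{(A)}_{n-1}(j)-\frac{a_0}{n^j}$ for $n\ge1$, $G^{(A)}_0(j):=0$; $L^{(A)}_n(j):=F^{(A)}_n(j)+(-1)^j\bar F^{(A)}_n(j)$; $R^{(A)}_n(j):=G^{(A)}_n(j)+(-1)^jL^{(A)}_n(j)$. *)

(* Defs.v *)
From HB Require Import structures.
From mathcomp Require Import all_boot all_order all_algebra.
From mathcomp Require Import complex.
From mathcomp Require Import all_classical all_reals all_analysis.

Set Implicit Arguments.
Unset Strict Implicit.
Unset Printing Implicit Defensive.

Import Order.TTheory GRing.Theory Num.Theory.
Import numFieldNormedType.Exports.

Local Open Scope classical_set_scope.
Local Open Scope complex_scope.
Local Open Scope ring_scope.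

(* [R[i]^o] is [R[i]] viewed as a normed module over itself; it is this alias
   that carries the topology used by limits and Landau notations. *)

(* Sum of a series indexed from 1; the value is only meaningful when the
   partial sums converge. *)
Definition csum1 (R : realType) (u : nat -> R[i]) : R[i] :=
  \big[+%R/0]_(1 <= k <oo) (u k : R[i]^o).

(* a_k = o(|k|^alpha) as k -> +oo and as k -> -oo. *)
Definition littleo_growth (R : realType) (a : int -> R[i]) (alpha : R) : Prop :=
  ((fun k : nat => a k%:Z : R[i]^o) =o_\oo
     (fun k : nat => (k%:R `^ alpha)%:C : R[i]^o)) /\
  ((fun k : nat => a (- k%:Z) : R[i]^o) =o_\oo
     (fun k : nat => (k%:R `^ alpha)%:C : R[i]^o)).

Section SequenceFunctions.
Variables (R : realType) (a : int -> R[i]).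

Definition PsiA (s : R[i]) : R[i] :=
  - (a 0 / s) + csum1 (fun k => a k%:Z / k%:R - a k%:Z / (k%:R + s)).

(* pi cot(pi s; A); no circular constant is involved in this definition. *)
Definition picotA (s : R[i]) : R[i] := - (a 0 / s) + PsiA (- s) - PsiA s.

Definition EA (n j : nat) : R[i] :=
  \sum_(1 <= k < n.+1) a (n%:Z - k%:Z) / k%:R ^+ j.

Definition EbarA (n j : nat) : R[i] :=
  \sum_(1 <= k < n.+1) a (k%:Z - n%:Z - 1) / k%:R ^+ j.

(* The sums below are only used for j >= 1. *)
Definition FA (n j : nat) : R[i] :=
  if j == 1%N then csum1 (fun k => (a (k%:Z + n%:Z) - a k%:Z) / k%:R)
  else csum1 (fun k => a (k%:Z + n%:Z) / k%:R ^+ j).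

Definition FbarA (n j : nat) : R[i] :=
  if j == 1%N then csum1 (fun k => (a (k%:Z - n%:Z) - a k%:Z) / k%:R)
  else csum1 (fun k => a (k%:Z - n%:Z) / k%:R ^+ j).

Definition GA (n j : nat) : R[i] :=
  if n == 0%N then 0 else EA n j - EbarA n.-1 j - a 0 / n%:R ^+ j.

Definition LA (n j : nat) : R[i] := FA n j + (-1) ^+ j * FbarA n j.

Definition RA (n j : nat) : R[i] := GA n j + (-1) ^+ j * LA n j.

End SequenceFunctions.

Definition sigma (R : realType) (n : int) : R[i] := if 0 <= n then 1 else -1.

(* Main.v *)
(** Write [s = n + t] with [n >= 0]. In the definition of [R_n(j)] all values of
    [a] at negative indices cancel, and
    [R_n(j) = \sum_(k >= 1) ((-1)^j a_(k+n) + a_|n-k|) / k^j]. Reindexing the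
    partial sums of the cotangent series gives likewise
    [pi cot(pi s; A) - a_n / t = \sum_(k >= 1) (a_|n-k| / (k+t) - a_(k+n) / (k-t))],
    because the finitely many boundary terms tend to 0. A finite geometric sum
    in [j] then turns the error of the [J]-th partial sum of the expansion into
    the single series of the terms
    [a_|n-k| (-t/k)^J / (k+t) - a_(k+n) (t/k)^J / (k-t)], which is
    [O(|t|^J \sum_k k^(beta-2))]; no interchange of infinite sums is needed.
    The case [n < 0] follows since the cotangent function is odd. *)

Require Import Defs.
From HB Require Import structures.
From mathcomp Require Import all_boot all_order all_algebra.
From mathcomp Require Import complex.
From mathcomp Require Import all_classical all_reals all_analysis.
From mathcomp Require Import zify ring lra.

Set Implicit Arguments.
Unset Strict Implicit.
Unset Printing Implicit Defensive.

Import Order.TTheory GRing.Theory Num.Theory.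
Import numFieldNormedType.Exports.

Local Open Scope classical_set_scope.
Local Open Scope complex_scope.
Local Open Scope ring_scope.

(** * Convergent sequences and series *)

Section Sequences.
Variable K : numFieldType.
Implicit Types (u v : nat -> K) (l c : K).

(* A record rather than a definition, so that unification never unfolds filters. *)
Record converges u l : Prop :=
  Converges { converges_cvg_to : (u : nat -> K^o) @ \oo --> (l : K^o) }.

Lemma convergesP u l : converges u l <->
  forall e, 0 < e -> exists N, forall n, (N <= n)%N -> `|l - u n| < e.
Proof.
split=> [[/cvgrPdist_lt ul] e /ul[N _ lN]|ul]; first by exists N.
by split; apply/cvgrPdist_lt => e /ul[N lN]; exists N.
Qed.

Lemma converges_lim u l : converges u l -> limn (u : nat -> K^o) = l.
Proof. by move=> [ul]; apply: cvg_lim => //; exact: norm_hausdorff. Qed.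

Lemma converges_cvg u l : converges u l -> cvgn (u : nat -> K^o).
Proof. by move=> [ul]; apply/cvg_ex; exists l. Qed.

Lemma converges_cst l : converges (fun=> l) l.
Proof. by split; exact: cvg_cst. Qed.

Lemma convergesD u v l l' : converges u l -> converges v l' ->
  converges (fun n => u n + v n) (l + l').
Proof. by move=> [ul] [vl]; split; exact: cvgD. Qed.

Lemma convergesN u l : converges u l -> converges (fun n => - u n) (- l).
Proof. by move=> [ul]; split; exact: cvgN. Qed.

Lemma convergesB u v l l' : converges u l -> converges v l' ->
  converges (fun n => u n - v n) (l - l').
Proof. by move=> [ul] [vl]; split; exact: cvgB. Qed.

Lemma convergesZ c u l : converges u l -> converges (fun n => c * u n) (c * l).
Proof. by move=> [ul]; split; exact: cvgMr. Qed.

Lemma converges_sum (I : Type) (r : seq I) (f : I -> nat -> K) (g : I -> K) :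
  (forall i, converges (f i) (g i)) ->
  converges (fun n => \sum_(i <- r) f i n) (\sum_(i <- r) g i).
Proof.
move=> fg; elim: r => [|i r IH].
  rewrite big_nil; have -> : (fun n => \sum_(i <- [::]) f i n) = (fun=> 0).
    by apply/funext => n; rewrite big_nil.
  exact: converges_cst.
rewrite big_cons; have -> : (fun n => \sum_(i <- i :: r) f i n) =
    (fun n => f i n + \sum_(i <- r) f i n).
  by apply/funext => n; rewrite big_cons.
exact: convergesD.
Qed.

Lemma converges_shift m u l : converges (fun n => u (n + m)%N) l <-> converges u l.
Proof.
split=> /convergesP ul; apply/convergesP => e /ul[N lN].
  by exists (N + m)%N => n Nn; have := lN (n - m)%N; rewrite subnK; [apply|]; lia.
by exists N => n Nn; apply: lN; lia.
Qed.

Lemma converges_eventually m u v l : (forall n, (m <= n)%N -> u n = v n) ->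
  converges u l -> converges v l.
Proof.
move=> uv /(converges_shift m u l) ul; apply/(converges_shift m v l).
have -> // : (fun n => v (n + m)%N) = (fun n => u (n + m)%N).
by apply/funext => n; rewrite uv ?leq_addl.
Qed.

Lemma eq_converges u v l : u =1 v -> converges u l -> converges v l.
Proof. by move=> /funext ->. Qed.

Lemma norm_converges_le u l c :
  converges u l -> (forall n, `|u n| <= c) -> `|l| <= c.
Proof.
move=> /convergesP ul uc; apply/ler_addgt0Pl => e /ul[N /(_ N (leqnn _)) lN].
by rewrite -(subrK (u N) l) (le_trans (ler_normD _ _))// lerD// ltW.
Qed.

Lemma converges_dominated m u v : (forall n, (m <= n)%N -> `|u n| <= v n) ->
  converges v 0 -> converges u 0.
Proof.
move=> uv /convergesP v0; apply/convergesP => e /v0[N vN].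
exists (N + m)%N => n Nn; have nm : (m <= n)%N by lia.
have := vN n ltac:(lia); rewrite !sub0r !normrN; apply: le_lt_trans.
(* The order of [K] may be partial; [|u n| <= v n] makes [v n] real and nonnegative, so that
   [|v n| = v n]. *)
by rewrite (le_trans (uv n nm))// ger0_norm// (le_trans _ (uv n nm)).
Qed.

Definition convergent_series u : Prop := exists l, converges (fun N => \sum_(0 <= k < N) u k) l.

End Sequences.

(** * Comparison tests for real and complex series *)

Section ComplexSequences.
Variable R : realType.

Lemma converges_real_complex (x : R^nat) (l : R) :
  x n @[n --> \oo] --> l -> converges (fun n => (x n)%:C) l%:C.
Proof.
(* In [R[i]], [0 < e] forces the imaginary part of [e] to be 0, so the radius is a positive real. *)
move=> /cvgrPdist_lt xl; apply/convergesP => -[e e'] /[!ltcE] /= /andP[/eqP -> e0].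
have [N _ xN] := xl _ e0; exists N => n /xN /=.
rewrite -rmorphB normc_def /= expr0n addr0 sqrtr_sqr => lt_e.
by change (`|l - x n|%:C < e%:C); rewrite ltcR.
Qed.

Lemma is_cvg_series_dominated (x w : R^nat) (B : R) :
  (forall k, `|x k| <= w k) -> (forall N, \sum_(0 <= k < N) w k <= B) ->
  cvgn (fun N => \sum_(0 <= k < N) x k).
Proof.
move=> xw wB; apply: normed_cvg; apply: nondecreasing_is_cvgn.
  move=> m n; apply: (@nondecreasing_series R (fun k => `|x k|) xpredT 0%N) => k _ _.
  exact: normr_ge0.
exists B => _ [N _ <-]; by apply: le_trans (wB N); apply: ler_sum_nat => k _; exact: xw.
Qed.

Lemma normc_ge_Im (z : R[i]) : `|complex.Im z|%:C <= `|z|.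
Proof. by rewrite normc_def lecR -sqrtr_sqr ler_wsqrtr// lerDr sqr_ge0. Qed.

Lemma convergent_series_dominated (u : nat -> R[i]) (w : R^nat) (B : R) :
  (forall k, `|u k| <= (w k)%:C) -> (forall N, \sum_(0 <= k < N) w k <= B) ->
  convergent_series u.
Proof.
move=> uw wB.
(* [f] will be the real or the imaginary part; the two limits are recombined at the end as
   [r + 'i * i]. *)
have part (f : R[i] -> R) : additive f -> (forall z, `|f z|%:C <= `|z|) ->
    exists l, converges (fun N => (f (\sum_(0 <= k < N) u k))%:C) l.
  move=> fB f_le.
  have f0 : f 0 = 0 by rewrite -(subrr 0) fB subrr.
  have fD y z : f (y + z) = f y + f z.
    by rewrite -[in LHS](opprK z) fB -[in f (- z)]sub0r fB f0 sub0r opprK.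
  have fu k : `|f (u k)| <= w k by rewrite -lecR (le_trans (f_le _)).
  have /cvg_ex[l /converges_real_complex fl] := is_cvg_series_dominated fu wB.
  exists l%:C; apply: eq_converges fl => N.
  by rewrite (big_morph f fD f0).
have [r ul] := part (@complex.Re R) (raddfB _) (@normc_ge_Re _).
have [i ui] := part (@complex.Im R) (raddfB _) normc_ge_Im.
exists (r + 'i%C * i).
apply: eq_converges (convergesD ul (convergesZ 'i%C ui)) => N.
by case: (\sum_(0 <= k < N) u k) => p q; rewrite [RHS]complexE.
Qed.

End ComplexSequences.

(** * The majorant k^(beta - 2) *)

Section PowerMajorant.
Variable R : realType.
Implicit Types (beta : R) (x : R).

(* Convexity: [ln x <= ln (x + 1) - 1 / (x + 1)], then [expR t >= 1 + t]. *)
Lemma powR_telescope beta x : beta < 1 -> 0 < x ->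
  (1 - beta) * ((x + 1) `^ beta / (x + 1) ^+ 2) <=
  x `^ (beta - 1) - (x + 1) `^ (beta - 1).
Proof.
move=> beta1 x0; have y0 : 0 < x + 1 by rewrite addr_gt0.
have xy : -1 < - (x + 1)^-1 by rewrite ltrN2 invf_lt1// ltrDr.
have lnxy : ln x <= ln (x + 1) - (x + 1)^-1.
  have -> : ln x = ln ((x + 1) * (1 - (x + 1)^-1)).
    by congr ln; field; rewrite gt_eqF.
  rewrite lnM ?posrE//; last by rewrite -ltrBlDl sub0r.
  by rewrite lerD2l le_ln1Dx.
have yE : (x + 1) `^ beta = (x + 1) * (x + 1) `^ (beta - 1).
  rewrite -[X in X * _]powRr1 ?ltW// -powRD.
    by congr (_ `^ _); ring.
  by rewrite (gt_eqF y0) implybT.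
move: yE; set p := (x + 1) `^ (beta - 1) => yE.
have -> : (x + 1) `^ beta / (x + 1) ^+ 2 = p / (x + 1).
  by rewrite yE; field; rewrite gt_eqF.
have p0 : 0 < p by rewrite powR_gt0.
(* The quotient of the two powers is an exponential, to which the bound [1 + y <= expR y]
   applies. *)
have -> : x `^ (beta - 1) = p * expR ((1 - beta) * (ln (x + 1) - ln x)).
  by rewrite /p /powR !gt_eqF// -expRD; congr expR; ring.
have pE e : p * e - p = p * (e - 1) by ring.
rewrite mulrCA pE ler_pM2l//.
rewrite lerBrDl (le_trans _ (expR_ge1Dx _))// lerD2l ler_pM2l ?subr_gt0//.
by rewrite lerBrDl -lerBrDr.
Qed.

Lemma powR_series_bound beta : beta < 1 -> exists B, forall N,
  \sum_(0 <= k < N) k.+1%:R `^ beta / k.+1%:R ^+ 2 <= B.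
Proof.
move=> beta1; have e0 : 0 < 1 - beta by rewrite subr_gt0.
have c0 : 0 <= (1 - beta)^-1 by rewrite invr_ge0 ltW.
(* The subtracted power is the telescoped remainder that carries the induction; each step is
   [powR_telescope] at [N.+1]. *)
have bound N : \sum_(0 <= k < N.+1) k.+1%:R `^ beta / k.+1%:R ^+ 2 <=
    1 + (1 - beta)^-1 * (1 - N.+1%:R `^ (beta - 1)).
  elim: N => [|N IH].
    by rewrite big_nat1 !powR1 subrr mulr0 addr0 expr1n divr1.
  rewrite big_nat_recr//= (le_trans (lerD IH (lexx _)))//.
  rewrite -addrA lerD2l -(ler_pM2l e0) mulrDr !mulVKf ?gt_eqF//.
  have := powR_telescope beta1 (ltr0Sn R N); rewrite natr1.
  move: (_ * _) (N.+1%:R `^ _) (N.+2%:R `^ (beta - 1)) => u v w; lra.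
exists (1 + (1 - beta)^-1) => -[|N]; first by rewrite big_geq// addr_ge0.
by rewrite (le_trans (bound N))// lerD2l ler_piMr// gerBl powR_ge0.
Qed.

Lemma powR_cvg0_nat beta : beta < 1 ->
  (n%:R `^ beta / n%:R : R) @[n --> \oo] --> 0.
Proof.
move=> beta1; have e0 : 0 < 1 - beta by rewrite subr_gt0.
apply/cvgr0Pnorm_lt => e epos.
(* Chosen so that [M ^ (1 - beta) = 1 / e], while [n ^ beta / n = 1 / n ^ (1 - beta)]. *)
set M := e^-1 `^ (1 - beta)^-1.
have M0 : 0 < M by rewrite powR_gt0 ?invr_gt0.
exists (Num.bound M) => // n /= Mn.
have nM : M < n%:R.
  by rewrite (lt_le_trans (archi_boundP (ltW M0)))// ler_nat.
have n0 : 0 < n%:R :> R by exact: lt_trans nM.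
have -> : n%:R `^ beta / n%:R = (n%:R `^ (1 - beta))^-1 :> R.
  rewrite -powRN -(powR_inv1 (ltW n0)) -powRD.
    by congr (_ `^ _); ring.
  by rewrite (gt_eqF n0) implybT.
rewrite ger0_norm ?invr_ge0 ?powR_ge0// invf_plt ?posrE ?powR_gt0//.
have -> : e^-1 = M `^ (1 - beta).
  by rewrite /M -powRrM mulVf ?gt_eqF// powRr1// invr_ge0 ltW.
by apply: gt0_ltr_powR => //; rewrite ?inE ?nnegrE ltW.
Qed.

End PowerMajorant.

(** * Complex series indexed from 1, and explicit growth bounds for [a] *)

Section ComplexSums.
Variable R : realType.
Implicit Types (u v : nat -> R[i]) (l c : R[i]) (beta C B : R).

(** Starting at 1, as [csum1] does, keeps out the term at 0, which is often a division by zero. *)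
Definition sums u l : Prop := converges (fun N => \sum_(1 <= k < N) u k) l.

Lemma csum1_sums u l : sums u l -> csum1 u = l.
Proof. exact: converges_lim. Qed.

Lemma sumsD u v l l' : sums u l -> sums v l' -> sums (fun k => u k + v k) (l + l').
Proof.
move=> ul vl; apply: eq_converges (convergesD ul vl) => N.
by rewrite big_split.
Qed.

Lemma sumsZ c u l : sums u l -> sums (fun k => c * u k) (c * l).
Proof.
move=> ul; apply: eq_converges (convergesZ c ul) => N.
by rewrite mulr_sumr.
Qed.

Lemma sumsB u v l l' : sums u l -> sums v l' -> sums (fun k => u k - v k) (l - l').
Proof.
move=> ul vl; apply: eq_converges (convergesB ul vl) => N.
by rewrite sumrB.
Qed.

Lemma sums_sum (I : Type) (r : seq I) (f : I -> nat -> R[i]) (g : I -> R[i]) :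
  (forall i, sums (f i) (g i)) ->
  sums (fun k => \sum_(i <- r) f i k) (\sum_(i <- r) g i).
Proof.
move=> fg; apply: eq_converges (converges_sum r fg) => N.
exact: exchange_big.
Qed.

Lemma eq_sums u v l : (forall k, (0 < k)%N -> u k = v k) -> sums u l -> sums v l.
Proof.
move=> uv; apply: eq_converges => N.
by apply: eq_big_nat => k /andP[k0 _]; exact: uv.
Qed.

Lemma sums_unshift m u l : sums (fun k => u (k + m)%N) l ->
  sums u (l + \sum_(1 <= k < m.+1) u k).
Proof.
move=> ul; apply/(converges_shift m).
(* At [N = 0] the partial sums may differ: the one of [u] then misses the term [u m]. *)
apply: (@converges_eventually _ 1%N _ _ _ _
  (convergesD ul (converges_cst (\sum_(1 <= k < m.+1) u k)))) => N N0.
rewrite /= [RHS](big_cat_nat (n := m.+1))//=; last by lia.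
by rewrite addrC -[in RHS]add1n big_addn addnK.
Qed.

(** The bound is asked only beyond [K], since for small [k] a denominator [k + z] may be small or
    zero; the first [K] terms are split off and added back. *)
Lemma sums_dominated K C beta u : beta < 1 -> 0 <= C ->
  (forall k, (K < k)%N -> `|u k| <= (C * (k%:R `^ beta / k%:R ^+ 2))%:C) ->
  exists l, sums u l.
Proof.
move=> beta1 C0 uC; have [B wB] := powR_series_bound beta1.
pose w k : R := k.+1%:R `^ beta / k.+1%:R ^+ 2.
have w0 k : 0 <= w k by rewrite divr_ge0 ?powR_ge0// exprn_ge0.
have [|N|l ul] := @convergent_series_dominated _ (fun k => u (k + K).+1)
    (fun k => C * w (k + K)%N) (C * B).
- by move=> k; apply: uC; lia.
- rewrite -mulr_sumr ler_wpM2l// (le_trans _ (wB (N + K)%N))//.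
  rewrite (big_cat_nat (n := K) (m := 0%N) (p := (N + K)%N))//= ?leq_addl//.
  rewrite -[in X in _ <= _ + X](add0n K) big_addn addnK lerDr.
  by rewrite sumr_ge0.
exists (l + \sum_(1 <= k < K.+1) u k); apply: sums_unshift.
apply/(converges_shift 1); apply: eq_converges ul => N.
by rewrite [RHS]big_add1 addn1 /=; apply: eq_bigr => k _; rewrite addSn.
Qed.

(** [B] is an argument so that one value serves a whole family of series in which only [C]
    varies. *)
Lemma norm_sums_le C beta B u l :
  (forall N, \sum_(0 <= k < N) k.+1%:R `^ beta / k.+1%:R ^+ 2 <= B) -> 0 <= C ->
  (forall k, (0 < k)%N -> `|u k| <= (C * (k%:R `^ beta / k%:R ^+ 2))%:C) ->
  sums u l -> `|l| <= (C * B)%:C.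
Proof.
move=> wB C0 uC ul; apply: (norm_converges_le ul) => N.
rewrite (le_trans (ler_norm_sum _ _ _))// big_add1.
apply: (@le_trans _ _ ((C * \sum_(0 <= k < N.-1) k.+1%:R `^ beta / k.+1%:R ^+ 2)%:C)).
  rewrite mulr_sumr rmorph_sum.
  by apply: ler_sum_nat => k _; exact: uC.
by rewrite lecR ler_wpM2l.
Qed.

(** Taking [beta = max(alpha, 0)] makes [k ^ beta] nondecreasing and at least 1 for [k >= 1], so
    finitely many exceptional values and a shift of the index by [n] are absorbed into the
    constant. *)
Lemma littleo_growth_le (a : int -> R[i]) (alpha : R) :
  alpha < 1 -> littleo_growth a alpha ->
  exists2 beta, beta < 1 & forall n : nat, exists2 C, 0 <= C &
    forall (k : nat) (i : int), (0 < k)%N -> (`|i|%N <= k + n)%N ->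
      `|a i| <= (C * k%:R `^ beta)%:C.
Proof.
move=> alpha1 [/eqoP/(_ 1 ltr01)[K1 _ aK1] /eqoP/(_ 1 ltr01)[K2 _ aK2]].
set beta := Num.max alpha 0.
have beta0 : 0 <= beta by rewrite le_max lexx orbT.
exists beta; first by rewrite gt_max alpha1 ltr01.
pose g i := complex.Re `|a i|.
have gE i : `|a i| = (g i)%:C by rewrite /g normc_def.
have g0 i : 0 <= g i by rewrite -ler0c -gE.
pose K := (K1 + K2).+1.
(* The sum covers the indices of absolute value below [K]; the summand 1 covers the others. *)
pose C0 := 1 + \sum_(0 <= m < K) (g m%:Z + g (- m%:Z)).
have C01 : 1 <= C0 by rewrite lerDl sumr_ge0// => m _; rewrite addr_ge0.
have pow1 (m : nat) : 1 <= m.+1%:R `^ beta :> R.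
  by rewrite -[X in X <= _](powRr0 m.+1%:R) ler_powR// ler1n.
have small (m : nat) : (m < K)%N -> g m%:Z + g (- m%:Z) <= C0.
  move=> mK; rewrite /C0 big_mkord (bigD1 (Ordinal mK))//= addrCA lerDl.
  by rewrite addr_ge0// sumr_ge0// => j _; rewrite addr_ge0.
have large (m : nat) (x : R) : (K <= m)%N -> x <= `|m%:R `^ alpha| ->
    x <= C0 * m.+1%:R `^ beta.
  move=> Km /le_trans; apply; rewrite ger0_norm ?powR_ge0//.
  apply: (@le_trans _ _ (m.+1%:R `^ beta)); last by rewrite ler_peMl ?powR_ge0.
  apply: (@le_trans _ _ (m%:R `^ beta)).
    by rewrite ler_powR ?le_max ?lexx// ler1n; lia.
  by apply: ge0_ler_powR => //; rewrite ?nnegrE// ler_nat.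
have gbound (i : int) : g i <= C0 * `|i|%N.+1%:R `^ beta.
  have nrm (x : R) : `|x%:C| = `|x|%:C.
    by rewrite normc_def /= expr0n addr0 sqrtr_sqr.
  have [m [-> |->]] : exists m : nat, i = m%:Z \/ i = - m%:Z.
  - by exists `|i|%N; lia.
  - rewrite absz_nat; have [mK|Km] := ltnP m K.
      rewrite (le_trans _ (ler_peMr _ (pow1 m)))//; last exact: le_trans C01.
      by rewrite (le_trans _ (small m mK))// lerDl.
    apply: large => //; have := aK1 m; rewrite mul1r nrm gE lecR; apply.
    by rewrite /=; lia.
  - rewrite abszN absz_nat; have [mK|Km] := ltnP m K.
      rewrite (le_trans _ (ler_peMr _ (pow1 m)))//; last exact: le_trans C01.
      by rewrite (le_trans _ (small m mK))// lerDr.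
    apply: large => //; have := aK2 m; rewrite mul1r nrm gE lecR; apply.
    by rewrite /=; lia.
(* From [|i| <= k + n] and [k >= 1] follows [|i| + 1 <= (n + 2) k]. *)
move=> n; exists (C0 * n.+2%:R `^ beta) => [|k i k0 ik].
  by rewrite mulr_ge0 ?powR_ge0// (le_trans ler01).
rewrite gE lecR (le_trans (gbound i))// -mulrA ler_wpM2l ?(le_trans ler01)//.
rewrite -powRM// -natrM ge0_ler_powR ?nnegrE// ler_nat; nia.
Qed.

End ComplexSums.

(** * The series defining the cotangent and the coefficients *)

Section Cotangent.
Variable R : realType.
Implicit Types (a : int -> R[i]) (beta : R) (s t z w : R[i]) (n j k : nat).

(** The norm of [R[i]] has values in [R[i]]; [mod] is the same number in [R], where the order is
    total. *)
Local Notation mod z := (complex.Re `|z|).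

Lemma modE z : `|z| = (mod z)%:C.
Proof. by rewrite normc_def. Qed.

Lemma norm_le_mod z (x : R) : (`|z| <= x%:C) = (mod z <= x).
Proof. by rewrite modE lecR. Qed.

Lemma mod_ge0 z : 0 <= mod z.
Proof. by rewrite -ler0c -modE. Qed.

Lemma modM z w : mod (z * w) = mod z * mod w.
Proof. by apply: (@complexI R); rewrite rmorphM /= -!modE normrM. Qed.

Lemma modV z : mod z^-1 = (mod z)^-1.
Proof. by apply: (@complexI R); rewrite fmorphV /= -!modE normfV. Qed.

Lemma mod_nat k : mod (k%:R : R[i]) = k%:R.
Proof. by apply: (@complexI R); rewrite -modE normr_nat rmorph_nat. Qed.

Lemma modN z : mod (- z) = mod z.
Proof. by rewrite normrN. Qed.

Lemma modX z k : mod (z ^+ k) = mod z ^+ k.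
Proof. by apply: (@complexI R); rewrite rmorphXn /= -!modE normrX. Qed.

Lemma ler_modD z w : mod (z + w) <= mod z + mod w.
Proof. by rewrite -lecR rmorphD /= -!modE ler_normD. Qed.

Lemma lerB_modD z w : mod z - mod w <= mod (z + w).
Proof. by rewrite -lecR rmorphB /= -!modE lerB_normD. Qed.

(** One constant, depending on [n], serves the indices [k + n], [k - n] and [|n - k|] alike. *)
Definition power_growth a beta := forall n, exists2 C : R, 0 <= C &
  forall k (i : int), (0 < k)%N -> (`|i|%N <= k + n)%N ->
    mod (a i) <= C * k%:R `^ beta.

Lemma half_le_mod z : exists K : nat, forall k, (K < k)%N ->
  k%:R / 2 <= mod (k%:R + z).
Proof.
exists (Num.bound (2 * mod z)) => k Kk.
have : 2 * mod z < k%:R.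
  apply: lt_trans (archi_boundP _) _; last by rewrite ltr_nat.
  by rewrite mulr_ge0 ?mod_ge0.
have := lerB_modD k%:R z; rewrite mod_nat.
by move: (mod z) (mod (_ + _)) => x y; lra.
Qed.

(** For large [k] the quotient is at most [2 C k ^ (beta - 1)]. This makes the boundary terms of the
    later reindexing vanish. *)
Lemma growth_over_shift_cvg0 a beta z : beta < 1 -> power_growth a beta ->
  converges (fun k => a k%:Z / (k%:R + z)) 0.
Proof.
move=> beta1 /(_ 0%N)[C C0 aC]; have [K zK] := half_le_mod z.
have := converges_real_complex (powR_cvg0_nat beta1).
move=> /(convergesZ (C * 2)%:C); rewrite mulr0.
apply: (converges_dominated (m := K.+1)) => k Kk.
have k0 : (0 < k)%N by lia.
have kR0 : 0 < k%:R :> R by rewrite ltr0n.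
rewrite -rmorphM norm_le_mod modM modV.
have z0 : 0 < mod (k%:R + z) by rewrite (lt_le_trans _ (zK _ Kk))// divr_gt0.
apply: (@le_trans _ _ (C * k%:R `^ beta * (k%:R / 2)^-1)).
  apply: ler_pM; rewrite ?mod_ge0 ?invr_ge0 ?mod_ge0//.
    by apply: aC => //; lia.
  by rewrite lef_pV2 ?posrE ?divr_gt0// zK.
by rewrite le_eqVlt; apply/orP; left; apply/eqP; field; rewrite gt_eqF.
Qed.

(** Each term beyond [K] equals [a_k s / (k (k + s))], which is of order [k ^ (beta - 2)]. *)
Lemma psi_sums a beta s : beta < 1 -> power_growth a beta ->
  exists l, sums (fun k => a k%:Z / k%:R - a k%:Z / (k%:R + s)) l.
Proof.
move=> beta1 /(_ 0%N)[C C0 aC]; have [K sK] := half_le_mod s.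
apply: (@sums_dominated _ K (C * 2 * mod s) beta) => // [|k Kk].
  by rewrite !mulr_ge0 ?mod_ge0.
have k0 : (0 < k)%N by lia.
have kR0 : 0 < k%:R :> R by rewrite ltr0n.
have s0 : 0 < mod (k%:R + s) by rewrite (lt_le_trans _ (sK _ Kk))// divr_gt0.
have kC0 : k%:R != 0 :> R[i] by rewrite pnatr_eq0 -lt0n.
have sC0 : k%:R + s != 0 by apply: contraTneq s0 => ->; rewrite normr0 ltxx.
have -> : a k%:Z / k%:R - a k%:Z / (k%:R + s) =
    a k%:Z * (s / k%:R) / (k%:R + s) by field; rewrite sC0 kC0.
rewrite norm_le_mod !modM !modV mod_nat.
apply: (@le_trans _ _ (C * k%:R `^ beta * (mod s / k%:R) * (k%:R / 2)^-1)).
  apply: ler_pM; rewrite ?invr_ge0 ?mulr_ge0 ?invr_ge0 ?mod_ge0//.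
    by rewrite ler_wpM2r ?divr_ge0 ?mod_ge0// aC//; lia.
  by rewrite lef_pV2 ?posrE ?divr_gt0// sK.
by rewrite le_eqVlt; apply/orP; left; apply/eqP; field; rewrite gt_eqF.
Qed.

(** A shift by [n] is made of [n] unit shifts, each giving a telescoping series that converges
    because [d] tends to 0. *)
Lemma shift_difference_sums (d : nat -> R[i]) n : converges d 0 ->
  exists l, sums (fun k => d (k + n)%N - d k) l.
Proof.
move=> d0; elim: n => [|n [l dl]].
  exists 0; apply: eq_converges (converges_cst 0) => N.
  by rewrite big1// => k _; rewrite addn0 subrr.
have tel : sums (fun k => d (k + n).+1 - d (k + n)%N) (0 - d (1 + n)%N).
  have dn : converges (fun N => d (N + n)%N) 0 by apply/converges_shift.
  apply: (@converges_eventually _ 1%N _ _ _ _ (convergesB dn (converges_cst _))) => N N1.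
  rewrite (telescope_sumr_eq (fun k => d (k + n)%N))//.
exists (0 - d (1 + n)%N + l); apply: eq_sums (sumsD tel dl) => k _.
by rewrite addnS; ring.
Qed.

(** With [d k = a_k / k], the term is [d (k + n) - d k] plus [a_(k+n) n / (k (k + n))], and the
    latter is dominated. *)
Lemma FA1_sums a beta n : beta < 1 -> power_growth a beta ->
  exists l, sums (fun k => (a (k%:Z + n%:Z) - a k%:Z) / k%:R) l.
Proof.
move=> beta1 ag.
have d0 : converges (fun k => a k%:Z / k%:R) 0.
  apply: eq_converges (growth_over_shift_cvg0 0 beta1 ag) => k.
  by rewrite addr0.
have [l dl] := shift_difference_sums n d0.
have [C C0 aC] := ag n.
have [|k k0|l' el] := @sums_dominated _ 0 (C * n%:R) beta
    (fun k => a (k%:Z + n%:Z) * n%:R / (k%:R * (k + n)%:R)) beta1.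
- by rewrite mulr_ge0.
- have kR0 : 0 < k%:R :> R by rewrite ltr0n.
  rewrite norm_le_mod !modM modV modM !mod_nat.
  apply: (@le_trans _ _ (C * k%:R `^ beta * n%:R / (k%:R * k%:R))).
    apply: ler_pM; rewrite ?invr_ge0 ?mulr_ge0 ?mod_ge0//.
      by rewrite ler_wpM2r// aC//; lia.
    by rewrite lef_pV2 ?posrE ?mulr_gt0 ?ltr0n ?addn_gt0 ?k0// ler_pM2l// ler_nat leq_addr.
  by rewrite le_eqVlt; apply/orP; left; apply/eqP; field; rewrite gt_eqF.
exists (l + l'); apply: eq_sums (sumsD dl el) => k k0.
rewrite PoszD natrD; field.
by rewrite pnatr_eq0 -lt0n k0 -natrD pnatr_eq0 -lt0n addn_gt0 k0.
Qed.

(** At index [k + n] the term is [(a_k - a_(k+n)) / (k + n)], which differs from minus the term of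
    [FA1_sums] by a dominated one. The first [n] terms are added back. *)
Lemma FbarA1_sums a beta n : beta < 1 -> power_growth a beta ->
  exists l, sums (fun k => (a (k%:Z - n%:Z) - a k%:Z) / k%:R) l.
Proof.
move=> beta1 ag; have [l Fl] := FA1_sums n beta1 ag.
have [C C0 aC] := ag n.
have [|k k0|l' el] := @sums_dominated _ 0 (2 * C * n%:R) beta
    (fun k => (a (k%:Z + n%:Z) - a k%:Z) * n%:R / (k%:R * (k + n)%:R)) beta1.
- by rewrite !mulr_ge0.
- have kR0 : 0 < k%:R :> R by rewrite ltr0n.
  rewrite norm_le_mod !modM modV modM !mod_nat.
  apply: (@le_trans _ _ (2 * (C * k%:R `^ beta) * n%:R / (k%:R * k%:R))).
    apply: ler_pM; rewrite ?invr_ge0 ?mulr_ge0 ?mod_ge0//.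
      rewrite ler_wpM2r// (le_trans (ler_modD _ _))// modN mulr_natl mulr2n.
      by rewrite lerD// aC//; lia.
    by rewrite lef_pV2 ?posrE ?mulr_gt0 ?ltr0n ?addn_gt0 ?k0// ler_pM2l// ler_nat leq_addr.
  by rewrite le_eqVlt; apply/orP; left; apply/eqP; field; rewrite gt_eqF.
exists (l' - l + \sum_(1 <= k < n.+1) (a (k%:Z - n%:Z) - a k%:Z) / k%:R).
apply: sums_unshift; apply: eq_sums (sumsB el Fl) => k k0.
rewrite PoszD addrK natrD; field.
by rewrite pnatr_eq0 -lt0n k0 -natrD pnatr_eq0 -lt0n addn_gt0 k0.
Qed.

Lemma pow_sums a beta n j (f : nat -> int) : beta < 1 -> power_growth a beta ->
  (1 < j)%N -> (forall k, (`|f k|%N <= k + n)%N) ->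
  exists l, sums (fun k => a (f k) / k%:R ^+ j) l.
Proof.
move=> beta1 /(_ n)[C C0 aC] j1 fn.
apply: (@sums_dominated _ 0 C beta) => // k k0.
rewrite norm_le_mod modM modV modX mod_nat mulrA.
apply: ler_pM; rewrite ?mod_ge0 ?invr_ge0 ?exprn_ge0 ?aC//.
by rewrite lef_pV2 ?posrE ?exprn_gt0 ?ltr0n// ler_weXn2l// ler1n.
Qed.

End Cotangent.

(** * The coefficients as single series, and the cotangent series recentred at [n] *)

Section Expansion.
Variable R : realType.
Implicit Types (a : int -> R[i]) (beta : R) (s t z w : R[i]) (n j k : nat).

Local Notation mod z := (complex.Re `|z|).

(** The multiplicity [*+ (j == 1%N)] merges the two cases of [FA]: [a_k] is subtracted exactly when
    [j = 1]. *)
Lemma FA_sums a beta n j : beta < 1 -> power_growth a beta -> (0 < j)%N ->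
  sums (fun k => (a (k%:Z + n%:Z) - (a k%:Z *+ (j == 1%N))) / k%:R ^+ j) (FA a n j).
Proof.
move=> beta1 ag j0; rewrite /FA; case: eqVneq => [->|j1].
  have [l Fl] := FA1_sums n beta1 ag.
  by rewrite (csum1_sums Fl); apply: eq_sums Fl => k _; rewrite mulr1n expr1.
have jgt1 : (1 < j)%N by rewrite ltn_neqAle eq_sym j1.
have fn k : (`|(k%:Z + n%:Z)%R|%N <= k + n)%N by lia.
have [l Fl] := pow_sums beta1 ag jgt1 fn.
by rewrite (csum1_sums Fl); apply: eq_sums Fl => k _; rewrite mulr0n subr0.
Qed.

Lemma FbarA_sums a beta n j : beta < 1 -> power_growth a beta -> (0 < j)%N ->
  sums (fun k => (a (k%:Z - n%:Z) - (a k%:Z *+ (j == 1%N))) / k%:R ^+ j)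
    (FbarA a n j).
Proof.
move=> beta1 ag j0; rewrite /FbarA; case: eqVneq => [->|j1].
  have [l Fl] := FbarA1_sums n beta1 ag.
  by rewrite (csum1_sums Fl); apply: eq_sums Fl => k _; rewrite mulr1n expr1.
have jgt1 : (1 < j)%N by rewrite ltn_neqAle eq_sym j1.
have fn k : (`|(k%:Z - n%:Z)%R|%N <= k + n)%N by lia.
have [l Fl] := pow_sums beta1 ag jgt1 fn.
by rewrite (csum1_sums Fl); apply: eq_sums Fl => k _; rewrite mulr0n subr0.
Qed.

(** [EbarA] at [n - 1] supplies the values [a_(k-n)] for [k < n], and [a 0 / n ^ j] is the missing
    term [k = n]. *)
Lemma GA_E a n j : GA a n j =
  \sum_(1 <= k < n.+1) (a `|n%:Z - k%:Z| - a (k%:Z - n%:Z)) / k%:R ^+ j.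
Proof.
rewrite /GA; case: n => [|n] /=; first by rewrite big_geq.
rewrite /EA /EbarA -addrA -opprD.
have -> : \sum_(1 <= k < n.+1) a (k%:Z - n%:Z - 1) / k%:R ^+ j + a 0 / n.+1%:R ^+ j
    = \sum_(1 <= k < n.+2) a (k%:Z - n.+1%:Z) / k%:R ^+ j.
  rewrite [RHS]big_nat_recr//= subrr; congr (_ + _); apply: eq_bigr => k _.
  by congr (a _ / _); lia.
rewrite -sumrB; apply: eq_big_nat => k /andP[_ kn].
by rewrite mulrBl; congr (a _ / _ - _); lia.
Qed.

(* The values of [a] at negative indices, which occur in [FbarA] and [EbarA],
   cancel out. *)
Lemma RA_sums a beta n j : beta < 1 -> power_growth a beta -> (0 < j)%N ->
  sums (fun k => ((-1) ^+ j * a (k%:Z + n%:Z) + a `|n%:Z - k%:Z|) / k%:R ^+ j)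
    (RA a n j).
Proof.
move=> beta1 ag j0.
have LAs := sumsZ ((-1) ^+ j) (sumsD (FA_sums n beta1 ag j0)
  (sumsZ ((-1) ^+ j) (FbarA_sums n beta1 ag j0))).
have GAs : sums (fun k => (a `|n%:Z - k%:Z| - a (k%:Z - n%:Z)) / k%:R ^+ j) (GA a n j).
  (* Beyond [k = n] both indices are [k - n], so the terms vanish and the finite sum is also the sum
     of a series. *)
  rewrite GA_E -[X in sums _ X]add0r; apply: sums_unshift.
  apply: eq_converges (converges_cst 0) => N; rewrite big1// => k _.
  by rewrite (_ : `|n%:Z - (k + n)%N%:Z| = (k + n)%N%:Z - n%:Z); [rewrite subrr mul0r|lia].
apply: eq_sums (sumsD GAs LAs) => k _.
(* For [j = 1] the copies of [a_k] subtracted in [FA] and [FbarA] cancel, as [FbarA] enters [LA]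
   with sign -1. *)
case: (eqVneq j 1%N) => [->|_] /=; first by rewrite mulr1n; ring.
by rewrite mulr0n -signr_odd; case: (odd j); ring.
Qed.

Lemma picotA_sums a beta s : beta < 1 -> power_growth a beta ->
  sums (fun k => a k%:Z / (k%:R + s) - a k%:Z / (k%:R - s)) (picotA a s - a 0 / s).
Proof.
move=> beta1 ag; have [l Pl] := psi_sums s beta1 ag.
have [l' Pl'] := psi_sums (- s) beta1 ag.
rewrite /picotA /PsiA (csum1_sums Pl) (csum1_sums Pl') invrN.
rewrite (_ : _ - _ = l' - l); last by ring.
by apply: eq_sums (sumsB Pl' Pl) => k _; ring.
Qed.

Lemma picotAN a s : picotA a (- s) = - picotA a s.
Proof. by rewrite /picotA opprK invrN; ring. Qed.

(** The indices [n - k] and [k + n] with [1 <= k <= n] fill the interval from 0 to [2 n] except for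
    its centre. *)
Lemma sum_symmetric (p : nat -> R[i]) n :
  \sum_(1 <= k < n.+1) (p (n - k)%N + p (k + n)%N) =
  \sum_(0 <= i < (n + n).+1) p i - p n.
Proof.
rewrite big_split /= [in RHS](big_cat_nat (n := n))//=; last by lia.
rewrite [X in _ = _ + X - _]big_ltn; last by lia.
rewrite big_add1 /= [X in _ = X + _ - _]big_nat_rev /= add0n.
have -> : \sum_(n.+1 <= i < (n + n).+1) p i = \sum_(1 <= k < n.+1) p (k + n)%N.
  by rewrite -[in LHS]add1n -addSn big_addn addnK.
rewrite big_add1 /=; ring.
Qed.

Lemma picotA_shift_sums a beta n t : beta < 1 -> power_growth a beta ->
  sums (fun k => a `|n%:Z - k%:Z| / (k%:R + t) - a (k%:Z + n%:Z) / (k%:R - t))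
    (picotA a (n%:R + t) - a n%:Z / t).
Proof.
move=> beta1 ag; set s := n%:R + t; set h := (X in sums X _).
pose p i := a i%:Z / (i%:R - s); pose q i := a i%:Z / (i%:R + s).
(* For [k <= n] the term is [- p (n - k) - p (k + n)]; for [k > n] it is [q (k - n) - p (k + n)].
   The omitted centre [p n] equals [- a_n / t], the polar part. *)
have hpq m : \sum_(1 <= k < m + n.+1) h k =
    \sum_(1 <= i < m.+1) q i - \sum_(0 <= i < m + (n + n).+1) p i + p n.
  elim: m => [|m IH].
    rewrite !add0n [X in _ = X - _ + _]big_geq// add0r -[RHS]opprK opprD opprK -(sum_symmetric p).
    rewrite -sumrN; apply: eq_big_nat => k /andP[_ kn].
    rewrite /h /p opprD; congr (_ - _).
      rewrite natrB// -mulrN -(invrN (n%:R - k%:R - s)); congr (a _ / _); first by lia.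
      by rewrite /s; ring.
    by rewrite PoszD natrD; congr (_ / _); rewrite /s; ring.
  rewrite !addSn big_nat_recr/=; last by lia.
  rewrite IH [X in _ = X - _ + _]big_nat_recr//= [X in _ = _ - X + _]big_nat_recr//=.
  have -> : h (m + n.+1)%N = q m.+1 - p (m + (n + n).+1)%N.
    rewrite /h /q /p; congr (a _ / _ - a _ / _); try lia.
      by rewrite /s -!natr1 !natrD -natr1; ring.
    by rewrite /s !natrD -!natr1 !natrD; ring.
  ring.
have p0 : converges p 0 by exact: growth_over_shift_cvg0 beta1 ag.
(* The sum of [p] runs [2 n] indices further than that of [q]; these boundary terms tend to 0. *)
have tail : converges (fun m => \sum_(0 <= i < n + n) p (m + (i + 1))%N)
    (\sum_(0 <= i < n + n) 0).
  by apply: converges_sum => i; apply/converges_shift.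
rewrite big1// in tail.
apply/(converges_shift n.+1).
have c := (converges_shift 1 _ _).2 (picotA_sums s beta1 ag).
have := convergesD (convergesB c tail) (converges_cst (a 0 / s + p n)).
rewrite (_ : _ + (a 0 / s + p n) = picotA a s - a n%:Z / t); last first.
  have -> : p n = - (a n%:Z / t).
    by rewrite /p -mulrN -(invrN t); congr (_ / _); rewrite /s; ring.
  by ring.
apply: eq_converges => m; rewrite hpq sumrB addn1.
rewrite [X in _ = _ - X + _](big_cat_nat (n := m.+1))//=; last by lia.
rewrite [X in _ = _ - (X + _) + _]big_ltn//.
have -> : \sum_(m.+1 <= i < m + (n + n).+1) p i =
    \sum_(0 <= i < n + n) p (m + (i + 1))%N.
  rewrite -[m.+1]add0n big_addn (_ : (_ - m.+1 = n + n)%N); last by lia.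
  by apply: eq_bigr => i _; congr p; lia.
have -> : p 0%N = - (a 0 / s) by rewrite /p sub0r invrN mulrN.
ring.
Qed.

End Expansion.

(** * The expansion *)

Section Main.
Variable R : realType.
Implicit Types (a : int -> R[i]) (beta : R) (s t z w : R[i]) (n j k : nat).

Local Notation mod z := (complex.Re `|z|).

Lemma geometric_remainder (F : fieldType) (x t : F) (J : nat) :
  x != 0 -> x - t != 0 ->
  (x - t)^-1 - \sum_(0 <= j < J) t ^+ j / x ^+ j.+1 = (t / x) ^+ J / (x - t).
Proof.
move=> x0 xt; elim: J => [|J IH]; first by rewrite big_geq// subr0 expr0 mul1r.
rewrite big_nat_recr//= opprD addrA IH !expr_div_n !exprS; field.
by rewrite xt x0 expf_neq0.
Qed.

(** Here [e] stands for [(-1) ^ j]. The identity separates the coefficient of [x], a power of [t],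
    from that of [y], a power of [- t]. *)
Lemma sign_split (F : comNzRingType) (e u v x y : F) : e ^+ 2 = 1 ->
  -1 * e * u * ((-1 * e * x + y) * v) = x * (u * v) - y * (e * u * v).
Proof.
move=> ee; transitivity (e ^+ 2 * (x * (u * v)) - y * (e * u * v)); first by ring.
by rewrite ee mul1r.
Qed.

(** One factor [1 / k] comes from [|k - t| >= k - |t| >= k (1 - |t|)], the other from [J >= 1]. *)
Lemma mod_remainder_le t k J : mod t < 1 -> (0 < k)%N -> (0 < J)%N ->
  k%:R - t != 0 /\
  mod ((t / k%:R) ^+ J / (k%:R - t)) <= mod t ^+ J / (1 - mod t) / k%:R ^+ 2.
Proof.
move=> t1 k0 J0.
have k1 : 1 <= k%:R :> R by rewrite ler1n.
have kR0 : 0 < k%:R :> R by rewrite ltr0n.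
have t0 : 0 < 1 - mod t by rewrite subr_gt0.
have kt : k%:R * (1 - mod t) <= mod (k%:R - t).
  apply: le_trans (lerB_modD _ _); rewrite modN mod_nat mulrBr mulr1 lerB//.
  by rewrite ler_peMl ?mod_ge0.
have kt0 : 0 < mod (k%:R - t) by rewrite (lt_le_trans _ kt)// mulr_gt0.
split; first by apply: contraTneq kt0 => ->; rewrite normr0 ltxx.
rewrite modM modV modX modM modV mod_nat expr_div_n.
apply: (@le_trans _ _ (mod t ^+ J / k%:R * (k%:R * (1 - mod t))^-1)).
  apply: ler_pM; rewrite ?invr_ge0 ?divr_ge0 ?exprn_ge0 ?mod_ge0//.
    rewrite ler_wpM2l ?exprn_ge0 ?mod_ge0// lef_pV2 ?posrE ?exprn_gt0//.
    by rewrite -[X in X <= _]expr1 ler_weXn2l.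
  by rewrite lef_pV2 ?posrE ?mulr_gt0.
by rewrite le_eqVlt; apply/orP; left; apply/eqP; field; rewrite !gt_eqF.
Qed.

Lemma picotA_expansion a beta n t : beta < 1 -> power_growth a beta -> mod t < 1 ->
  converges (fun J => \sum_(0 <= j < J) (-1) ^+ j.+1 * RA a n j.+1 * t ^+ j)
    (a n%:Z / t - picotA a (n%:R + t)).
Proof.
move=> beta1 ag t1; set S := fun J => _; set L := a n%:Z / t - _.
have [B wB] := powR_series_bound beta1.
have [C C0 aC] := ag n.
have t0 : 0 < 1 - mod t by rewrite subr_gt0.
(* The factor 2 counts the geometric remainders at [t] and at [- t]; neither [C] nor [B] depends on
   [J]. *)
have bound J : (0 < J)%N -> `|S J - L| <= (2 * C * (mod t ^+ J / (1 - mod t)) * B)%:C.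
  move=> J0.
  have Hs := picotA_shift_sums n t beta1 ag.
  have Rs : sums (fun k => \sum_(0 <= j < J) (-1) ^+ j.+1 * t ^+ j *
      (((-1) ^+ j.+1 * a (k%:Z + n%:Z) + a `|n%:Z - k%:Z|) / k%:R ^+ j.+1))
      (\sum_(0 <= j < J) (-1) ^+ j.+1 * t ^+ j * RA a n j.+1).
    by apply: sums_sum => j; apply: sumsZ; apply: RA_sums beta1 ag _.
  (* The sum over [j] is finite, so it passes inside the sum over [k], and the error becomes the
     value of one series. *)
  have := sumsD Hs Rs; rewrite (_ : _ + _ = S J - L); last first.
    rewrite addrC opprB; congr (_ + _).
    by apply: eq_bigr => j _; rewrite mulrAC.
  apply: norm_sums_le wB _ _.
    by rewrite !mulr_ge0 ?invr_ge0 ?exprn_ge0 ?mod_ge0// ltW.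
  move=> k k0; have [kt kt_le] := mod_remainder_le t1 k0 J0.
  have tN1 : mod (- t) < 1 by rewrite modN.
  have [kNt kNt_le] := mod_remainder_le tN1 k0 J0.
  have kC0 : k%:R != 0 :> R[i] by rewrite pnatr_eq0 -lt0n.
  rewrite opprK modN in kNt kNt_le.
  set x := a (k%:Z + n%:Z); set y := a `|n%:Z - k%:Z|.
  have -> : \sum_(0 <= j < J) (-1) ^+ j.+1 * t ^+ j *
      (((-1) ^+ j.+1 * x + y) / k%:R ^+ j.+1) =
      x * (\sum_(0 <= j < J) t ^+ j / k%:R ^+ j.+1) -
      y * (\sum_(0 <= j < J) (- t) ^+ j / k%:R ^+ j.+1).
    rewrite !mulr_sumr -sumrB; apply: eq_bigr => j _.
    rewrite [(- t) ^+ j]exprNn exprS.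
    exact: sign_split (sqrr_sign _ j).
  have := geometric_remainder J kC0 kt.
  have := geometric_remainder (t := - t) J kC0; rewrite opprK => /(_ kNt).
  move: (\sum_(0 <= j < J) _) (\sum_(0 <= j < J) _) => g g' gE g'E.
  have -> : y / (k%:R + t) - x / (k%:R - t) + (x * g - y * g') =
      y * ((- t / k%:R) ^+ J / (k%:R + t)) - x * ((t / k%:R) ^+ J / (k%:R - t)).
    by rewrite -gE -g'E; ring.
  rewrite norm_le_mod (le_trans (ler_modD _ _))// modN !modM.
  set r := mod t ^+ J / (1 - mod t).
  apply: (@le_trans _ _ (C * k%:R `^ beta * (r / k%:R ^+ 2) +
    C * k%:R `^ beta * (r / k%:R ^+ 2))).
    2: by rewrite le_eqVlt; apply/orP; left; apply/eqP; ring.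
  apply: lerD; rewrite -modM; apply: ler_pM; rewrite ?mod_ge0 ?aC//; lia.
have lim0 : converges (fun J => (2 * C / (1 - mod t) * B)%:C * (mod t ^+ J)%:C) 0.
  rewrite -[0](mulr0 (2 * C / (1 - mod t) * B)%:C); apply: convergesZ.
  by apply: converges_real_complex; apply: cvg_expr; rewrite ger0_norm ?mod_ge0.
have SL0 : converges (fun J => S J - L) 0.
  apply: (converges_dominated (m := 1%N)) lim0 => J J0.
  apply: le_trans (bound J J0) _; rewrite -rmorphM lecR le_eqVlt.
  by apply/orP; left; apply/eqP; ring.
have := convergesD SL0 (converges_cst L); rewrite add0r.
by apply: eq_converges => J; rewrite subrK.
Qed.

End Main.

Theorem theorem2p3 (R : realType) (a : int -> R[i]) (alpha : R)
    (alpha_lt1 : alpha < 1) (ha : littleo_growth a alpha)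
    (n : int) (s : R[i]) (hsn : `|s - n%:~R| < 1) (s_neq_n : s != n%:~R) :
  let term (j : nat) : R[i] :=
    (- sigma R n) ^+ j * RA a `|n|%N j * (s - n%:~R) ^+ j.-1 in
  cvgn (fun N : nat => \sum_(1 <= j < N) (term j : R[i]^o)) /\
  picotA a s = a `|n|%:Z / (s - n%:~R) - csum1 term.
Proof.
move=> term.
have [beta beta1 ag] : exists2 beta, beta < 1 & power_growth a beta.
  have [beta beta1 ag] := littleo_growth_le alpha_lt1 ha.
  exists beta => // m; have [C C0 aC] := ag m; exists C => // k i k0 ik.
  by rewrite -norm_le_mod aC.
suff termS : sums term (a `|n|%:Z / (s - n%:~R) - picotA a s).
  split; first exact: converges_cvg termS.
  by rewrite (csum1_sums termS) opprB addrC subrK.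
apply/(converges_shift 1).
have -> : (fun N => \sum_(1 <= j < N + 1) term j) =
    (fun N => \sum_(0 <= j < N) term j.+1).
  by apply/funext => N; rewrite addn1 big_add1.
have tC (z : R[i]) : `|z| < 1 -> complex.Re `|z| < 1 by rewrite -ltcR -modE.
rewrite {}/term /sigma; case: (lerP 0 n) => n0.
  have nE : n%:~R = `|n|%N%:R :> R[i] by rewrite -[in LHS](gez0_abs n0).
  have {s_neq_n}sE : s = `|n|%N%:R + (s - n%:~R) by rewrite nE addrC subrK.
  have := picotA_expansion `|n|%N beta1 ag (tC _ hsn); rewrite -sE.
  by apply: eq_converges => N; apply: eq_bigr => j _.
have nE : n%:~R = - `|n|%N%:R :> R[i].
  by rewrite -[in LHS](opprK n) -(ltz0_abs n0) rmorphN.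
(* The point [- s] is close to [|n|], so the expansion applies there with [- (s - n)] in place of
   [t]; oddness then returns to [s]. *)
have sE : - s = `|n|%N%:R + - (s - n%:~R) by rewrite nE; ring.
have t1 : complex.Re `|- (s - n%:~R)| < 1 by rewrite normrN tC.
have := convergesN (picotA_expansion `|n|%N beta1 ag t1).
rewrite -sE picotAN invrN mulrN -opprD opprK.
apply: eq_converges => N; rewrite -sumrN; apply: eq_bigr => j _.
(* Here [- sigma = 1]; on the other side [(-1) ^ (j + 1)], the power of [- (s - n)] and the outer
   minus combine to the sign [e ^ 2 = 1]. *)
rewrite opprK expr1n mul1r [(- _) ^+ j]exprNn exprS.
have := sqrr_sign R[i] j; move: ((-1) ^+ j) => e ee.
transitivity (e ^+ 2 * RA a `|n|%N j.+1 * (s - n%:~R) ^+ j); first by ring.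
by rewrite ee mul1r.
Qed.
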